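(* Let $X$ be a pre-Hilbert space. Then $X$ is non-pathological if and only if there exist an ordinal $\delta$ and separable sub-inner-product-spaces $X_\alpha$, $\alpha<\delta$, of $X$ which are pairwise orthogonal (i.e. $(\mathbf{x},\mathbf{y})=0$ whenever $\mathbf{x}\in X_\alpha$, $\mathbf{y}\in X_\beta$, $\alpha\neq\beta$) and such that the linear span of $\bigcup_{\alpha<\delta}X_\alpha$ is dense in $X$.
   Context: The scalar field $K$ is $\mathbb{R}$ or $\mathbb{C}$. A pre-Hilbert space is an inner product space over $K$ which need not be complete. A sub-inner-product-space of $X$ is a linear subspace of $X$ with the restricted inner product. An orthonormal basis of a pre-Hilbert space $X$ is an orthonormal subset of $X$ whose linear span is dense in $X$; $X$ is pathological if it has no orthonormal basis and non-pathological otherwise. *)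

(* Defs.v *)
From HB Require Import structures.
From mathcomp Require Import all_boot all_order all_algebra sesquilinear.
From mathcomp Require Import complex.
From mathcomp Require Import all_classical all_reals all_analysis.
From mathcomp Require wochoice.

Set Implicit Arguments.
Unset Strict Implicit.
Unset Printing Implicit Defensive.

Import GRing.Theory Num.Theory.
Local Open Scope classical_set_scope.
Local Open Scope ring_scope.

Variant scalar_kind := RealScalars | ComplexScalars.

Definition scalar (R : realType) (k : scalar_kind) : numFieldType :=
  match k with
  | RealScalars => R
  | ComplexScalars => R[i]
  end.

Definition scalar_conj (R : realType) (k : scalar_kind) :
    {rmorphism scalar R k -> scalar R k} :=
  match k return {rmorphism scalar R k -> scalar R k} with
  | RealScalars => @idfun R
  | ComplexScalars => @Num.conj R[i]
  end.

(* Mathcomp norms take values in the scalar field, so that [inner_norm] is an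
   equation in [scalar R k].  It determines the norm, hence the topology. The
   library's convention makes [inner] linear in its first argument and
   conjugate-linear in the second. *)
Record preHilbert (R : realType) (k : scalar_kind) := PreHilbert {
  preHilbert_sort :> normedModType (scalar R k);
  inner : {dot preHilbert_sort for @scalar_conj R k};
  inner_norm : forall x : preHilbert_sort, `|x| ^+ 2 = inner x x
}.

Definition lin_span (K : numFieldType) (V : lmodType K) (A : set V) : set V :=
  [set v | exists (n : nat) (c : 'I_n -> K) (a : 'I_n -> V),
    (forall i, A (a i)) /\ v = \sum_(i < n) c i *: a i].

Definition orthonormal_set (R : realType) (k : scalar_kind)
    (X : preHilbert R k) (B : set X) : Prop :=
  (forall x, B x -> inner X x x = 1) /\
  (forall x y, B x -> B y -> x <> y -> inner X x y = 0).

Definition orthonormal_basis (R : realType) (k : scalar_kind)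
    (X : preHilbert R k) (B : set X) : Prop :=
  orthonormal_set B /\ dense (lin_span B).

Definition pathological (R : realType) (k : scalar_kind)
    (X : preHilbert R k) : Prop :=
  ~ exists B : set X, orthonormal_basis B.

Definition non_pathological (R : realType) (k : scalar_kind)
    (X : preHilbert R k) : Prop := ~ pathological X.

(* Separability of [A] for the topology induced by [T]: for [D] included in
   [A], density of [D] in [A] means that [A] is included in the closure of
   [D] in [T].  The type [subspace A] of MathComp-Analysis is not used, because
   it makes the points outside [A] isolated instead of removing them. *)
Definition separable_set (T : topologicalType) (A : set T) : Prop :=
  exists D : set T, [/\ countable D, D `<=` A & A `<=` closure D].

Definition linear_subspace (K : numFieldType) (V : lmodType K) (A : set V) :
  Prop := GRing.submod_closed [in A].

(* An ordinal delta is represented by a well-ordered type, whose elements stand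
   for the ordinals alpha < delta; [ordinal_le] is the reflexive order. *)
Record set_ordinal := SetOrdinal {
  ordinal_sort :> Type;
  ordinal_le : rel ordinal_sort;
  ordinal_wo : wochoice.well_order ordinal_le
}.

(* Main.v *)
(* An orthonormal basis splits X into the lines it spans, each separable because
   the scalars have a countable dense subset. Conversely, Gram-Schmidt applied
   to a dense sequence of each X_alpha yields an orthonormal family inside
   X_alpha with the same span, and the union of these families over alpha is
   orthonormal because the X_alpha are pairwise orthogonal; the closure of its
   span is a subspace containing every X_alpha, hence is X. *)

Require Import Defs.
From mathcomp Require Import all_boot all_order all_algebra sesquilinear.
From mathcomp Require Import complex.
From mathcomp Require Import all_classical all_reals all_analysis.
From mathcomp Require wochoice.
Import Order.TTheory GRing.Theory Num.Theory.
Local Open Scope classical_set_scope.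
Local Open Scope ring_scope.

(** * Linear subspaces and spans *)

Lemma linear_subspaceP (K : numFieldType) (V : lmodType K) (S : set V) :
  linear_subspace S <->
  S 0 /\ (forall (a : K) (u v : V), S u -> S v -> S (a *: u + v)).
Proof.
split=> [[S0 Slin]|[S0 Slin]].
  split=> [|a u v Su Sv]; first exact: set_mem S0.
  by apply: set_mem; apply: Slin; apply: mem_set.
split=> [|a u v /set_mem Su /set_mem Sv]; first exact: mem_set.
exact: mem_set (Slin a u v Su Sv).
Qed.

Section LinearSpan.
Variables (K : numFieldType) (V : lmodType K).
Implicit Types (A S : set V).

Lemma linear_subspace_line (b : V) : linear_subspace (range ( *:%R^~ b : K -> V)).
Proof.
apply/linear_subspaceP; split=> [|a _ _ [c _ <-] [d _ <-]].
  by exists 0; rewrite ?scale0r.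
by exists (a * c + d); rewrite // scalerDl scalerA.
Qed.

Lemma linear_subspace_sum S (I : Type) (r : seq I) (P : pred I)
    (c : I -> K) (a : I -> V) :
  linear_subspace S -> (forall i, P i -> S (a i)) ->
  S (\sum_(i <- r | P i) c i *: a i).
Proof.
move=> /linear_subspaceP[S0 Slin] Sa.
elim/big_rec: _ => // i v Pi Sv; exact: Slin (Sa i Pi) Sv.
Qed.

Lemma subset_lin_span A : A `<=` lin_span A.
Proof.
move=> a Aa; exists 1%N, (fun=> 1), (fun=> a).
by rewrite big_ord1 scale1r.
Qed.

Lemma lin_span_subspace A : linear_subspace (lin_span A).
Proof.
apply/linear_subspaceP; split=> [|b _ _ [n [c [a [Aa ->]]]] [m [d [e [Ae ->]]]]].
  by exists 0%N, (fun=> 0), (fun=> 0); rewrite big_ord0; split=> // -[].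
exists (n + m)%N,
  (fun i : 'I_(n + m) =>
     match fintype.split i with inl j => b * c j | inr j => d j end),
  (fun i : 'I_(n + m) => match fintype.split i with inl j => a j | inr j => e j end).
split=> [i|]; first by case: fintype.split.
rewrite big_split_ord scaler_sumr /=; congr (_ + _); apply: eq_bigr => i _.
  by rewrite (unsplitK (inl i)) scalerA.
by rewrite (unsplitK (inr i)).
Qed.

Lemma lin_span_min A S : linear_subspace S -> A `<=` S -> lin_span A `<=` S.
Proof.
move=> Ssub AS _ [n [c [a [Aa ->]]]].
by apply: linear_subspace_sum => // i _; apply: AS.
Qed.

End LinearSpan.

(** * Closures of subspaces in a normed space *)

Section NormedClosure.
Variables (K : numFieldType) (V : normedModType K).
Implicit Types (A S : set V).

Lemma normed_closureP A (x : V) :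
  closure A x <-> forall e : K, 0 < e -> exists2 a, A a & `|x - a| < e.
Proof.
split=> [clA e e0|clA B /nbhs_ballP[e /= e0 eB]].
  have [a [Aa]] := clA _ (nbhsx_ballx x e e0).
  by rewrite -ball_normE; exists a.
have [a Aa xa] := clA e e0.
by exists a; split=> //; apply: eB; rewrite -ball_normE.
Qed.

Lemma dense_closureP A : dense A <-> closure A = setT.
Proof.
split=> [Ad|Acl U [x Ux] Uop].
  apply/seteqP; split=> // x _ B.
  rewrite nbhsE => -[U [Uop Ux] UB].
  have [a [Ua Aa]] := Ad U (ex_intro _ x Ux) Uop.
  by exists a; split=> //; apply: UB.
have Ax : closure A x by rewrite Acl.
by rewrite setIC; apply: Ax; apply: open_nbhs_nbhs.
Qed.

Lemma linear_subspace_closure S :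
  linear_subspace S -> linear_subspace (closure S).
Proof.
move=> /linear_subspaceP[S0 Slin]; apply/linear_subspaceP.
split=> [|a u v /normed_closureP Su /normed_closureP Sv].
  exact: subset_closure.
apply/normed_closureP => e e0.
have e2 : 0 < e / 2 by rewrite divr_gt0.
(* The tolerance for [u] is divided by [|a| + 1] rather than [|a|], so that [a = 0] needs no
   separate case. *)
have a1 : 0 < `|a| + 1 by rewrite ltr_wpDl.
have [u' Su' uu'] := Su (e / 2 / (`|a| + 1)) (divr_gt0 e2 a1).
have [v' Sv' vv'] := Sv (e / 2) e2.
exists (a *: u' + v'); first exact: Slin.
rewrite opprD addrACA -scalerBr (splitr e).
apply: le_lt_trans (ler_normD _ _) _; apply: ler_ltD => //.
rewrite normrZ; move: uu'; rewrite ltr_pdivlMr// => /ltW; apply: le_trans.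
by rewrite mulrC ler_wpM2l// lerDl.
Qed.

End NormedClosure.

(** * Gram-Schmidt orthogonalization, without normalization *)

Section GramSchmidt.
Variables (K : numFieldType) (theta : {rmorphism K -> K}) (V : lmodType K).
Variable form : {dot V for theta}.

(* A zero vector u contributes nothing, since then [form v u / 0 *: u] is 0; no
   hypothesis of independence is therefore needed. *)
Definition orth_rejection (s : seq V) (v : V) : V :=
  v - \sum_(u <- s) (form v u / form u u) *: u.

(** Each vector depends on all earlier ones, so the recursion carries the whole list of them to
    remain structural. *)
Fixpoint gram_schmidt_seq (d : nat -> V) (n : nat) : seq V :=
  if n is m.+1 then
    let s := gram_schmidt_seq d m in rcons s (orth_rejection s (d m))
  else [::].

Definition gram_schmidt (d : nat -> V) (n : nat) : V :=
  orth_rejection (gram_schmidt_seq d n) (d n).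

Lemma gram_schmidtE (d : nat -> V) (n : nat) :
  gram_schmidt d n = d n - \sum_(i < n)
    (form (d n) (gram_schmidt d i) /
       form (gram_schmidt d i) (gram_schmidt d i)) *: gram_schmidt d i.
Proof.
have gsE m : gram_schmidt_seq d m = mkseq (gram_schmidt d) m.
  by elim: m => //= m IHm; rewrite mkseqS -IHm.
rewrite [LHS]/gram_schmidt /orth_rejection gsE big_map.
have -> : iota 0 n = index_iota 0 n by rewrite /index_iota subn0.
by rewrite big_mkord.
Qed.

Lemma dot_eq0_sym (u v : V) : form u v = 0 -> form v u = 0.
Proof. by move/eqP; rewrite herm_eq0C => /eqP. Qed.

(** By symmetry [n < m]; strong induction on the larger index then leaves only the [n]-th term of
    the subtracted sum, which cancels [form (d m) (gram_schmidt d n)]. *)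
Lemma gram_schmidt_orthogonal (d : nat -> V) (m n : nat) :
  m != n -> form (gram_schmidt d m) (gram_schmidt d n) = 0.
Proof.
wlog lt_nm : m n / (n < m)%N.
  move=> H; case: (ltngtP m n) => // lt _; last by apply: H; rewrite ?gtn_eqF.
  by apply: dot_eq0_sym; apply: H; rewrite ?gtn_eqF.
move=> _; elim/ltn_ind: m n lt_nm => m IHm n lt_nm.
have orth (i : nat) : (i < m)%N -> i != n ->
    form (gram_schmidt d i) (gram_schmidt d n) = 0.
  move=> im; case: ltngtP => // [lt_in|lt_ni] _; last exact: IHm.
  by apply: dot_eq0_sym; apply: IHm.
rewrite gram_schmidtE linearBl linear_sumlz (bigD1 (Ordinal lt_nm)) //=.
rewrite big1 => [|i neq_in]; last by rewrite linearZl_LR/= orth ?mulr0.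
rewrite addr0 linearZl_LR/=.
(* If the [n]-th vector is zero, both terms vanish; otherwise its square [form] value is
   invertible. *)
have [->|gs0] := eqVneq (gram_schmidt d n) 0; first by rewrite linear0r !mul0r subr0.
by rewrite divfK ?subrr// lt0r_neq0// neq0_dnorm_gt0.
Qed.

Lemma gram_schmidt_mem (d : nat -> V) (S : set V) :
  linear_subspace S -> (forall n, S (d n)) -> forall n, S (gram_schmidt d n).
Proof.
move=> Ssub Sd; elim/ltn_ind => n IHn; rewrite gram_schmidtE addrC -scaleN1r.
have /linear_subspaceP[_ Slin] := Ssub; apply: Slin => //.
by apply: linear_subspace_sum => // i _; apply: IHn.
Qed.

Lemma gram_schmidt_span (d : nat -> V) (n : nat) :
  lin_span (range (gram_schmidt d)) (d n).
Proof.
set S := lin_span _; have Ssub : linear_subspace S by exact: lin_span_subspace.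
have Sgs i : S (gram_schmidt d i) by apply: subset_lin_span; exists i.
rewrite -[d n](subrK (\sum_(i < n) (form (d n) (gram_schmidt d i) /
  form (gram_schmidt d i) (gram_schmidt d i)) *: gram_schmidt d i)).
rewrite -gram_schmidtE -[gram_schmidt d n]scale1r.
have /linear_subspaceP[_ Slin] := Ssub; apply: Slin => //.
exact: linear_subspace_sum.
Qed.

End GramSchmidt.

Arguments gram_schmidt {K theta V} form d n.
Arguments gram_schmidt_orthogonal {K theta V} form d {m n}.
Arguments gram_schmidt_mem {K theta V} form {d S}.
Arguments gram_schmidt_span {K theta V} form d n.

(** * Countable density and conjugation in the scalar field *)

Lemma rat_approx (R : realType) (x e : R) :
  0 < e -> exists q : rat, `|x - ratr q| < e.
Proof.
move=> e0; have /rat_in_itvoo[q] : x - e < x + e by rewrite ltrD2l gtrN.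
by rewrite in_itv/= -ltr_distlC; exists q.
Qed.

(** The dense set is the rationals, or the complex numbers with rational real and imaginary parts.
    Pairs index both cases; the real one ignores the second component. *)
Lemma scalar_countable_dense (R : realType) (k : scalar_kind) :
  exists f : rat * rat -> Defs.scalar R k,
    forall (z e : Defs.scalar R k), 0 < e -> exists q, `|z - f q| < e.
Proof.
case: k => /=.
  exists (fun q => ratr q.1) => z e /rat_approx -/(_ z)[q zq].
  by exists (q, 0).
exists (fun q => (ratr q.1 +i* ratr q.2)%C) => -[a b] [e e'] /=.
(* Positivity in [R[i]] forces the imaginary part of the radius to be zero. *)
rewrite ltcE /= => /andP[/eqP -> e0].
have e2 : 0 < e / 2 by rewrite divr_gt0.
have [p ap] := rat_approx R a _ e2; have [q bq] := rat_approx R b _ e2.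
exists (p, q); rewrite normc_def ltcR /=.
apply: le_lt_trans (_ : `|a - ratr p| + `|b - ratr q| < e).
  rewrite -[leRHS]ger0_norm ?addr_ge0// -sqrtr_sqr ler_wsqrtr// [leRHS]sqrrD.
  by rewrite !real_normK ?num_real// lerD2r lerDl mulrn_wge0// mulr_ge0.
by rewrite (splitr e) ltrD.
Qed.

(** Norms are nonnegative scalars, hence real. This lets a norm factor leave the conjugate-linear
    argument of [inner]. *)
Lemma scalar_conj_norm (R : realType) (k : scalar_kind)
    (V : normedModType (Defs.scalar R k)) (x : V) :
  scalar_conj R k `|x| = `|x|.
Proof.
case: k V x => //= V x.
by apply: geC0_conj; apply: normr_ge0.
Qed.

(** * Separability and orthonormal bases in a pre-Hilbert space *)

Section PreHilbertSpaces.
Variables (R : realType) (k : scalar_kind) (X : preHilbert R k).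

Lemma separable_line (b : X) :
  separable_set (range ( *:%R^~ b : Defs.scalar R k -> X)).
Proof.
have [f fd] := scalar_countable_dense R k.
exists (range (fun q => f q *: b)); split.
- exact: sub_countable (card_image_le _ _) (countableP _).
- by move=> _ [q _ <-]; exists (f q).
- move=> _ [c _ <-]; apply/normed_closureP => e e0.
  have b1 : 0 < `|b| + 1 by rewrite ltr_wpDl.
  have [q cq] := fd c (e / (`|b| + 1)) (divr_gt0 e0 b1).
  exists (f q *: b); first by exists q.
  rewrite -scalerBl normrZ; move: cq; rewrite ltr_pdivlMr//; apply: le_lt_trans.
  by rewrite ler_wpM2l// lerDl.
Qed.

Lemma separable_dense_sequence (A : set X) : A !=set0 -> separable_set A ->
  exists d : nat -> X, (forall n, A (d n)) /\ A `<=` closure (range d).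
Proof.
move=> [a Aa] [D [/pfcard_geP Dcount DA Ad]].
(* A countable [D] is empty or the image of a sequence; the empty one has empty closure, which
   cannot contain [a]. *)
case: Dcount Ad DA => [->|[f] Ad DA].
  by rewrite closure0 => /(_ a Aa).
exists f; split=> [n|x /Ad].
  by apply: DA; exact: funS.
apply: closureS => y /(@surj _ _ _ _ f)[n _ <-]; by exists n.
Qed.

Lemma inner_normalized (x : X) : x != 0 ->
  inner X (`|x|^-1 *: x) (`|x|^-1 *: x) = 1.
Proof.
move=> x0; rewrite linearZl_LR linearZr_LR/= -inner_norm fmorphV scalar_conj_norm.
by rewrite mulrA -expr2 exprVn mulVf// expf_neq0// normr_eq0.
Qed.

(** The basis consists of the nonzero Gram-Schmidt vectors, normalized. Orthogonality within one
    sequence is automatic, so only distinct indices need a hypothesis. *)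
Lemma orthonormal_basis_of_sequences (I : Type) (d : I -> nat -> X) :
  (forall (i j : I) (m n : nat), i <> j ->
     inner X (gram_schmidt (inner X) (d i) m)
       (gram_schmidt (inner X) (d j) n) = 0) ->
  dense (lin_span (\bigcup_i range (d i))) ->
  exists B : set X, orthonormal_basis B.
Proof.
move=> dorth dd.
pose g i n := gram_schmidt (inner X) (d i) n.
have gorth i j m n : (i, m) <> (j, n) -> inner X (g i m) (g j n) = 0.
  have [<- im_jn|ij _] := pselect (i = j); last exact: dorth.
  by apply: gram_schmidt_orthogonal; apply/eqP => mn; apply: im_jn; rewrite mn.
exists [set b | exists i n, g i n != 0 /\ b = `|g i n|^-1 *: g i n].
split; [split|].
- by move=> _ [i [n [gn0 ->]]]; exact: inner_normalized.
- move=> _ _ [i [m [_ ->]]] [j [n [_ ->]]] neq.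
  rewrite linearZl_LR linearZr_LR/= gorth ?mulr0// => -[ij mn].
  by apply: neq; rewrite ij mn.
set S := lin_span _ in dd *.
set T := lin_span _.
suff ST : S `<=` T.
  by move=> U U0 Uop; have [x [Ux /ST Tx]] := dd U U0 Uop; exists x.
have Tsub : linear_subspace T by exact: lin_span_subspace.
apply: lin_span_min => // _ [i _ [n _ <-]].
apply: (lin_span_min _ _ _ _ Tsub _ _ (gram_schmidt_span (inner X) (d i) n)).
move=> _ [m _ <-].
(* A zero vector was left out of the basis but lies in [T]; a nonzero one is its norm times a basis
   vector. *)
rewrite -/(g i m); have [->|g0] := eqVneq (g i m) 0.
  by case/linear_subspaceP: Tsub.
rewrite -[g i m]scale1r -(@mulfV _ `|g i m|) ?normr_eq0// -scalerA.
rewrite -[_ *: _]addr0; have /linear_subspaceP[T0 Tlin] := Tsub.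
by apply: Tlin => //; apply: subset_lin_span; exists i, m.
Qed.

End PreHilbertSpaces.

Theorem theorem3p3 (R : realType) (k : scalar_kind) (X : preHilbert R k) :
  non_pathological X <->
  exists (delta : set_ordinal) (Y : delta -> set X),
    [/\ forall alpha, linear_subspace (Y alpha) /\ separable_set (Y alpha),
        forall (alpha beta : delta) (x y : X),
          alpha <> beta -> Y alpha x -> Y beta y -> inner X x y = 0
      & dense (lin_span (\bigcup_(alpha in [set: delta]) Y alpha))].
Proof.
split=> [/contrapT[B [[_ Borth] Bd]]|[delta [Y [Ysub Yorth Yd]]]].
  (* The basis itself, well-ordered by the axiom of choice, serves as the ordinal indexing the
     lines. *)
  have [le lewo] := wochoice.well_ordering_principle (set_type B).
  exists (SetOrdinal lewo),
    (fun b => range ( *:%R^~ (val b) : Defs.scalar R k -> X)).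
  split=> [b|a b _ _ neq [c _ <-] [c' _ <-]|].
  - by split; [exact: linear_subspace_line | exact: separable_line].
  - rewrite linearZl_LR linearZr_LR/= Borth ?mulr0//; [exact: set_valP..|].
    by move=> /val_inj.
  - move=> U U0 Uop; have [x [Ux Bx]] := Bd U U0 Uop; exists x; split=> //.
    apply: lin_span_min Bx; first exact: lin_span_subspace.
    move=> b Bb; apply: subset_lin_span; exists (SigSub (mem_set Bb)) => //.
    by exists 1; rewrite // scale1r.
have /choice[d dY] alpha : exists d : nat -> X,
    (forall n, Y alpha (d n)) /\ Y alpha `<=` closure (range d).
  have [/linear_subspaceP[Y0 _] Ysep] := Ysub alpha.
  by apply: separable_dense_sequence => //; exists 0.
apply; apply: (@orthonormal_basis_of_sequences _ _ _ _ d) => [a b m n ab|].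
  (* Gram-Schmidt stays inside each subspace, so orthogonality of the [Y alpha] passes to its
     outputs. *)
  apply: Yorth ab _ _; apply: gram_schmidt_mem;
    by [case: (Ysub a)|case: (dY a)|case: (Ysub b)|case: (dY b)].
set S := lin_span _; have Ssub : linear_subspace S by exact: lin_span_subspace.
move/dense_closureP: Yd => Yd; apply/dense_closureP/seteqP; split=> // x _.
have : closure (lin_span (\bigcup_(alpha in [set: delta]) Y alpha)) x by rewrite Yd.
(* With [closure S] replaced by its own closure, it is enough that [closure S], a subspace, contains
   every [Y alpha]. *)
rewrite ((closure_id _).1 (@closed_closure _ S)).
apply: closureS; apply: lin_span_min; first exact: linear_subspace_closure.
move=> y [alpha _ Yy]; have [_ /(_ y Yy)] := dY alpha.
by apply: closureS => z dz; apply: subset_lin_span; exists alpha.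
Qed.
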